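(* Let $G$ be a virtually nilpotent group and let $A\subseteq G$ be finite and non-empty. Set $\Gamma:=\langle A\rangle$. Assume that $A$ semigroup-generates $\Gamma$, i.e. $\Gamma=\bigcup_{h\ge1}A^h$. Then, for every $r\in\mathbb N$, there exist $l=l(A,r)\in\mathbb N$ and $h_0\in\mathbb N$ such that, for every integer $h\ge h_0$, there is a set $X_h\subseteq\Gamma$ with \[ |X_h|\le l\quad\text{and}\quad A^{rh}\subseteq X_hA^h . \] Thus $A$ is an asymptotic approximate group.
   Context: $\mathbb N=\{1,2,3,\dots\}$. For subsets $E,F$ of a group $G$: $EF=\{ef:e\in E,f\in F\}$, and for $h\ge1$, $E^h$ is the set of products of exactly $h$ elements of $E$. $\langle E\rangle$ is the subgroup generated by $E$. A group is virtually nilpotent if it contains a nilpotent subgroup of finite index (it need not be finitely generated). For $r,l\in\mathbb N$, a non-empty set $A\subseteq G$ is an asymptotic $(r,l)$-approximate group if there is $h_0\in\mathbb N$ such that for every integer $h\ge h_0$ there is a set $X_h\subseteq G$ with $|X_h|\le l$ and $A^{rh}\subseteq X_hA^h$. $A$ is an asymptotic approximate group if for every $r\in\mathbb N$ there exists $l=l(A,r)\in\mathbb N$ such that $A$ is an asymptotic $(r,l)$-approximate group. *)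

(* Defs.v *)
From mathcomp Require Import all_boot.
From mathcomp Require Import all_classical.

Set Implicit Arguments.
Unset Strict Implicit.
Unset Printing Implicit Defensive.

Local Open Scope classical_set_scope.
Local Open Scope card_scope.
Local Open Scope group_scope.

(* Groups are [groupType]s, possibly infinite; subsets are classical sets.
   The choiceType structure carried by a [groupType] is no restriction, as
   boolp equips every type with one. *)

Section Groups.
Variable G : groupType.
Implicit Types (E F H : set G) (x y : G) (h n : nat).

Definition set_mulg E F : set G := [set e * f | e in E & f in F].

(* Only h >= 1 matters; set_expg E 0 is [set 1]. *)
Definition set_expg E h : set G :=
  [set \prod_(i < h) e i | e in [set e : 'I_h -> G | forall i, E (e i)]].

Definition is_subgroup H : Prop := group_closed [in H].

Definition gen_subgroup E : set G := smallest is_subgroup E.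

Fixpoint lower_central H n : set G :=
  if n is n'.+1
  then gen_subgroup [set [~ x, y] | x in lower_central H n' & y in H]
  else H.

Definition is_nilpotent H : Prop := exists n, lower_central H n = [set 1].

Definition left_cosets H : set (set G) :=
  [set [set x * y | y in H] | x in [set: G]].

Definition finite_index H : Prop := finite_set (left_cosets H).

(* The cardinality bound |X| <= l forces X to be finite. *)
Definition asymptotic_rl_approximate_group (r l : nat) (A : set G) : Prop :=
  A !=set0 /\
  exists h0 : nat, (1 <= h0)%N /\
    forall h : nat, (h0 <= h)%N ->
      exists X : set G,
        X #<= `I_l /\ set_expg A (r * h)%N `<=` set_mulg X (set_expg A h).

Definition asymptotic_approximate_group (A : set G) : Prop :=
  forall r : nat, (1 <= r)%N ->
    exists l : nat, (1 <= l)%N /\ asymptotic_rl_approximate_group r l A.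

End Groups.

Definition virtually_nilpotent (G : groupType) : Prop :=
  exists H : set G, [/\ is_subgroup H, is_nilpotent H & finite_index H].

(* Main.v *)
(* Choose 1 in A^m. As A semigroup-generates Gamma, the ball of radius h in
   Gamma is covered by the translates a^-i A^h with i < m, so it is enough to
   cover balls of radius C n by boundedly many translates of balls of radius
   K n, where K does not depend on C. By Schreier's argument this may be done
   in a finitely generated nilpotent group.
   There, give an iterated commutator of generators its weight w, and let a word
   in such letters have size the sum of the n^-w. Collecting the occurrences of
   the lightest letter z to the left turns a word of bounded size into z^e V with V
   heavier and still of bounded size, because conjugation by a word of size S
   multiplies sizes by at most exp S. With N = n^w, write
   z^e = z^((q+1) N) z^-(N - f) with 0 <= f < N: boundedly many q occur, and
   z^(N - f) is, up to heavier letters, an element of length O(n). Induct on the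
   letters; those of large weight are trivial. *)
Require Import Defs.
From mathcomp Require Import all_boot.
From mathcomp Require Import all_classical.
From HB Require Import structures.
From mathcomp Require Import all_order all_algebra.
From mathcomp Require Import reals Rstruct sequences exp.

Set Implicit Arguments.
Unset Strict Implicit.
Unset Printing Implicit Defensive.

Import Order.TTheory GRing.Theory Num.Theory.

Local Open Scope group_scope.

(** * Commutator identities and formal commutators *)

Lemma conjg_mulR (G : groupType) (x y : G) : x ^ y = x * [~ x, y].
Proof. by rewrite commgEl mulVKg. Qed.

Lemma commMgJ (G : groupType) (x y z : G) :
  [~ x * y, z] = [~ x, z] ^ y * [~ y, z].
Proof. by rewrite !commgEl !conjgE !invgM !mulgA !mulgK. Qed.

Lemma commgMJ (G : groupType) (x y z : G) :
  [~ x, y * z] = [~ x, z] * [~ x, y] ^ z.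
Proof. by rewrite !commgEl !conjgE !invgM !mulgA !mulgK. Qed.

(** Commutators stay formal, since a group element does not determine the weight of an expression
    for it. *)
Inductive comm_tree (I : Type) : Type :=
  | Leaf of I
  | Node of comm_tree I & comm_tree I.

HB.instance Definition _ (I : Type) := gen_eqMixin (comm_tree I).

(** * Words in formal commutators and their weighted size *)

Section Words.
Variables (R : realType) (I : finType) (G : groupType) (s : I -> G).
Implicit Types (t u z : comm_tree I) (V W Z : seq (comm_tree I)) (q : R).

Fixpoint weight t : nat :=
  if t is Node t1 t2 then (weight t1 + weight t2)%N else 1%N.

Fixpoint ev t : G :=
  match t with Leaf i => s i | Node t1 t2 => [~ ev t1, ev t2] end.

Definition evw W : G := \prod_(t <- W) ev t.

Definition wnorm q W : R := (\sum_(t <- W) q ^+ weight t)%R.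

Lemma weight_gt0 t : 0 < weight t.
Proof. by elim: t => //= t IHt u _; rewrite addn_gt0 IHt. Qed.

Lemma evw_nil : evw [::] = 1.
Proof. exact: big_nil. Qed.

Lemma evw_cons t W : evw (t :: W) = ev t * evw W.
Proof. exact: big_cons. Qed.

Lemma evw_cat V W : evw (V ++ W) = evw V * evw W.
Proof. exact: big_cat. Qed.

Lemma evw_nseq n t : evw (nseq n t) = ev t ^+ n.
Proof.
by elim: n => [|n IHn]; rewrite ?evw_nil // [nseq _ _]/= evw_cons IHn expgS.
Qed.

Lemma wnorm_nil q : wnorm q [::] = 0%R.
Proof. exact: big_nil. Qed.

Lemma wnorm_cons q t W : wnorm q (t :: W) = (q ^+ weight t + wnorm q W)%R.
Proof. exact: big_cons. Qed.

Lemma wnorm_cat q V W : wnorm q (V ++ W) = (wnorm q V + wnorm q W)%R.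
Proof. exact: big_cat. Qed.

Lemma wnorm_nseq q n t : wnorm q (nseq n t) = (n%:R * q ^+ weight t)%R.
Proof.
elim: n => [|n IHn]; first by rewrite wnorm_nil mul0r.
by rewrite [nseq _ _]/= wnorm_cons IHn -addn1 natrD mulrDl mul1r addrC.
Qed.

Lemma wnorm_ge0 q W : (0 <= q)%R -> (0 <= wnorm q W)%R.
Proof. by move=> q0; apply: sumr_ge0 => t _; rewrite exprn_ge0. Qed.

Lemma count_le_wnorm q z W : (0 <= q)%R ->
  ((count_mem z W)%:R * q ^+ weight z <= wnorm q W)%R.
Proof.
move=> q0; elim: W => [|t W IHW]; first by rewrite wnorm_nil mul0r.
rewrite wnorm_cons [count_mem _ _]/= natrD mulrDl lerD //.
by case: eqP => [->|_]; rewrite ?mul1r // mul0r exprn_ge0.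
Qed.

(** * Conjugates and commutators of words *)

Definition conj1 W z := flatten [seq [:: t; Node t z] | t <- W].

Definition conjw W Z := foldl conj1 W Z.

(** From [t W, z] = [t, z]^W [W, z], and [commw] from [W, z Z] = [W, Z] [W, z]^Z. Like t^z = t
    [t, z], these identities introduce no inverse letters. *)
Fixpoint comm1 W z :=
  if W is t :: W' then conjw [:: Node t z] W' ++ comm1 W' z else [::].

Fixpoint commw W Z :=
  if Z is z :: Z' then commw W Z' ++ conjw (comm1 W z) Z' else [::].

Lemma conj1_cons t W z : conj1 (t :: W) z = [:: t, Node t z & conj1 W z].
Proof. by []. Qed.

Lemma evw_conj1 W z : evw (conj1 W z) = evw W ^ ev z.
Proof.
elim: W => [|t W IHW]; first by rewrite evw_nil conj1g.
by rewrite conj1_cons !evw_cons IHW conjMg [ev t ^ _]conjg_mulR mulgA.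
Qed.

Lemma evw_conjw W Z : evw (conjw W Z) = evw W ^ evw Z.
Proof.
elim: Z W => [|z Z IHZ] W; first by rewrite evw_nil conjg1.
by rewrite [conjw _ _]/= IHZ evw_conj1 evw_cons conjgM.
Qed.

Lemma evw_comm1 W z : evw (comm1 W z) = [~ evw W, ev z].
Proof.
elim: W => [|t W IHW]; first by rewrite evw_nil comm1g.
by rewrite /= evw_cat evw_conjw IHW !evw_cons evw_nil mulg1 -commMgJ.
Qed.

Lemma evw_commw W Z : evw (commw W Z) = [~ evw W, evw Z].
Proof.
elim: Z => [|z Z IHZ]; first by rewrite evw_nil commg1.
by rewrite /= evw_cat evw_conjw IHZ evw_comm1 evw_cons commgMJ.
Qed.

Lemma wnorm_conj1 q W z :
  wnorm q (conj1 W z) = (wnorm q W * (1 + q ^+ weight z))%R.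
Proof.
elim: W => [|t W IHW]; first by rewrite !wnorm_nil mul0r.
rewrite conj1_cons !wnorm_cons IHW /= exprD [RHS]mulrDl.
by rewrite [in RHS]mulrDr mulr1 addrA.
Qed.

(** Weights add in [Node], so a letter of [Z] of size x multiplies the norm by exactly 1 + x, which
    is at most exp x. *)
Lemma wnorm_conjw q W Z : (0 <= q)%R ->
  (wnorm q (conjw W Z) <= wnorm q W * expR (wnorm q Z))%R.
Proof.
move=> q0; elim: Z W => [|z Z IHZ] W; first by rewrite wnorm_nil expR0 mulr1.
rewrite [conjw _ _]/=; apply: le_trans (IHZ _) _.
rewrite wnorm_conj1 wnorm_cons expRD mulrA ler_wpM2r ?expR_ge0 //.
by rewrite ler_wpM2l ?wnorm_ge0 // expR_ge1Dx.
Qed.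

Lemma wnorm_comm1 q W z : (0 <= q)%R ->
  (wnorm q (comm1 W z) <= q ^+ weight z * (wnorm q W * expR (wnorm q W)))%R.
Proof.
move=> q0; elim: W => [|t W IHW]; first by rewrite !wnorm_nil mul0r mulr0.
rewrite /= wnorm_cat wnorm_cons mulrDl mulrDr.
have qt : (0 <= q ^+ weight t)%R by rewrite exprn_ge0.
have qz : (0 <= q ^+ weight z)%R by rewrite exprn_ge0.
have le : (expR (wnorm q W) <= expR (q ^+ weight t + wnorm q W))%R.
  by rewrite ler_expR lerDr.
apply: lerD.
  apply: le_trans (wnorm_conjw _ _ q0) _.
  rewrite wnorm_cons wnorm_nil addr0 /= exprD -mulrA mulrCA ler_wpM2l //.
  by rewrite ler_wpM2l.
by apply: le_trans IHW _; rewrite ler_wpM2l // ler_wpM2l ?wnorm_ge0.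
Qed.

(** Only the two norms enter the bound, so commutators of words of bounded norm have bounded norm,
    uniformly in the scale [q]. *)
Lemma wnorm_commw q W Z : (0 <= q)%R ->
  (wnorm q (commw W Z) <=
     (wnorm q W * expR (wnorm q W)) * (wnorm q Z * expR (wnorm q Z)))%R.
Proof.
move=> q0; set c := (_ * expR (wnorm q W))%R.
have c0 : (0 <= c)%R by rewrite mulr_ge0 ?wnorm_ge0 ?expR_ge0.
elim: Z => [|z Z IHZ]; first by rewrite !wnorm_nil mul0r mulr0.
rewrite /= wnorm_cat wnorm_cons mulrDl mulrDr addrC.
have qz : (0 <= q ^+ weight z)%R by rewrite exprn_ge0.
have le : (expR (wnorm q Z) <= expR (q ^+ weight z + wnorm q Z))%R.
  by rewrite ler_expR lerDr.
apply: lerD.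
  apply: le_trans (wnorm_conjw _ _ q0) _.
  rewrite mulrCA mulrA; apply: ler_pM => //; rewrite ?wnorm_ge0 ?expR_ge0 //.
  exact: wnorm_comm1.
by apply: le_trans IHZ _; rewrite ler_wpM2l // ler_wpM2l ?wnorm_ge0.
Qed.

(** * Leading letters and collection *)

Definition comm_closed (P : pred (comm_tree I)) :=
  forall t z, P t -> P (Node t z).

Lemma all_conj1 (P : pred (comm_tree I)) W z :
  comm_closed P -> all P W -> all P (conj1 W z).
Proof.
move=> clP; elim: W => //= t W IHW /andP[Pt PW].
by rewrite Pt clP // IHW.
Qed.

Lemma all_conjw (P : pred (comm_tree I)) W Z :
  comm_closed P -> all P W -> all P (conjw W Z).
Proof.
move=> clP; elim: Z W => //= z Z IHZ W PW.
by apply: IHZ; apply: all_conj1.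
Qed.

Lemma comm_closed_weight n : comm_closed (fun t => n < weight t).
Proof. by move=> t z nt; rewrite (leq_trans nt) //= leq_addr. Qed.

(** A word in such letters is, modulo heavier ones, a power of [z] whose exponent is the number of
    occurrences of [z]. *)
Definition led_by z t := (t == z) || (weight z < weight t).

Lemma comm_closed_led_by z : comm_closed (led_by z).
Proof.
move=> t u lt; apply/orP; right; rewrite /= -addn1.
case/orP: lt => [/eqP->|lt]; first by rewrite leq_add2l weight_gt0.
by rewrite (leq_trans _ (leq_addr _ _)) // addn1.
Qed.

(** The letters added by conjugation are [Node t u] with [t] led by [z], hence strictly heavier than
    [z]. *)
Lemma count_conjw z W Z : all (led_by z) W ->
  count_mem z (conjw W Z) = count_mem z W.
Proof.
elim: Z W => //= u Z IHZ W ledW; rewrite IHZ ?all_conj1 //; last first.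
  exact: comm_closed_led_by.
elim: W ledW {IHZ} => //= t W IHW /andP[ledt ledW]; rewrite IHW //.
have /negPf-> : Node t u != z; last by rewrite add0n.
apply/eqP => def_z; move: (weight_gt0 u); case/orP: ledt => [/eqP tz|].
  move/(congr1 weight): def_z; rewrite /= tz => /eqP.
  by rewrite -[X in _ == X]addn0 eqn_add2l => /eqP->.
by rewrite -def_z /= -[X in _ < X]addn0 ltn_add2l.
Qed.

Lemma led_by_Node z1 z2 t1 t2 : led_by z1 t1 -> led_by z2 t2 ->
  led_by (Node z1 z2) (Node t1 t2) /\
  ((Node t1 t2 == Node z1 z2) = (t1 == z1) && (t2 == z2)).
Proof.
move=> l1 l2; have E : (Node t1 t2 == Node z1 z2) = (t1 == z1) && (t2 == z2).
  by apply/eqP/andP => [[-> ->]|[/eqP-> /eqP->]]; rewrite ?eqxx.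
split=> //; rewrite /led_by E /=.
case/orP: l1 => [/eqP->|l1]; case/orP: l2 => [/eqP->|l2].
- by rewrite !eqxx.
- by rewrite ltn_add2l l2 orbT.
- by rewrite ltn_add2r l1 orbT.
- by rewrite -addSn leq_add ?orbT // ltnW.
Qed.

Lemma comm1_led_by z1 z2 W t : all (led_by z1) W -> led_by z2 t ->
  all (led_by (Node z1 z2)) (comm1 W t) /\
  count_mem (Node z1 z2) (comm1 W t) = (count_mem z1 W * (t == z2))%N.
Proof.
move=> lW lt; elim: W lW => //= x W IHW /andP[lx /IHW[IH1 IH2]].
have [l E] := led_by_Node lx lt.
have lx1 : all (led_by (Node z1 z2)) [:: Node x t] by rewrite /= l.
rewrite all_cat count_cat all_conjw ?count_conjw ?IH1 ?IH2 //=; last first.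
  exact: comm_closed_led_by.
by rewrite E addn0 mulnDl mulnb.
Qed.

(** Bilinearity of the commutator modulo heavier letters: each pair of a [z1] and a [z2] contributes
    one [Node z1 z2]. *)
Lemma commw_led_by z1 z2 W Z : all (led_by z1) W -> all (led_by z2) Z ->
  all (led_by (Node z1 z2)) (commw W Z) /\
  count_mem (Node z1 z2) (commw W Z) = (count_mem z1 W * count_mem z2 Z)%N.
Proof.
move=> lW; elim: Z => [|t Z IHZ] /=; first by rewrite muln0.
case/andP => lt /IHZ[IH1 IH2]; have [l E] := comm1_led_by lW lt.
rewrite all_cat count_cat all_conjw ?count_conjw ?IH1 ?IH2 ?E //; last first.
  exact: comm_closed_led_by.
by rewrite mulnDr addnC.
Qed.

(* Moving an occurrence of [z] to the front conjugates all it jumps over. *)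
Lemma extract_letter q (P : pred (comm_tree I)) z W : (0 <= q)%R ->
  comm_closed P -> all (fun t => (t == z) || P t) W ->
  exists V, [/\ all P V, evw W = ev z ^+ count_mem z W * evw V &
    (wnorm q V <= wnorm q W * expR ((count_mem z W)%:R * q ^+ weight z))%R].
Proof.
move=> q0 clP; elim/last_ind: W => [|W t IHW].
  by exists [::]; rewrite evw_nil !wnorm_nil mul0r mulg1.
rewrite all_rcons => /andP[Pt /IHW[V [PV eV nV]]].
rewrite -cats1 count_cat evw_cat wnorm_cat [count _ [:: t]]/= addn0.
rewrite evw_cons evw_nil mulg1 eV wnorm_cons wnorm_nil addr0.
have qt : (0 <= q ^+ weight t)%R by rewrite exprn_ge0.
case: eqP Pt => [-> _|_ /= Pt].
  (* Here V z = z V^z, and the factor 1 + q^(weight z) from the conjugation is absorbed by the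
     exponential. *)
  exists (conj1 V z); rewrite all_conj1 // evw_conj1 addn1 expgSr; split=> //.
    by rewrite -!mulgA [evw V * _]conjgC.
  rewrite wnorm_conj1 -addn1 natrD [((_ + 1) * _)%R]mulrDl mul1r expRD mulrA.
  apply: ler_pM; rewrite ?wnorm_ge0 ?addr_ge0 ?exprn_ge0 ?expR_ge1Dx //.
  apply: le_trans nV _; rewrite ler_wpM2r ?expR_ge0 //.
  by rewrite lerDl exprn_ge0.
exists (V ++ [:: t]); rewrite all_cat PV /= Pt evw_cat evw_cons evw_nil mulg1.
rewrite addn0 mulgA; split=> //.
rewrite wnorm_cat wnorm_cons wnorm_nil addr0 mulrDl lerD //.
rewrite ler_peMr // -[leLHS]expR0 ler_expR mulr_ge0 ?ler0n ?exprn_ge0 //.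
Qed.

End Words.

(** * Balls in a finitely generated group and short powers *)

Section Doubling.
Variables (R : realType) (I : finType) (G : groupType) (s : I -> G).
Hypothesis sV : forall i, exists j, s j = (s i)^-1.
Implicit Types (t u z : comm_tree I) (V W Z : seq (comm_tree I)).

Definition ball n g := exists2 w : seq I, size w <= n & \prod_(i <- w) s i = g.

Lemma ballW m n g : m <= n -> ball m g -> ball n g.
Proof. by move=> mn [w wm <-]; exists w => //; apply: leq_trans mn. Qed.

Lemma ball1 n : ball n 1.
Proof. by exists [::]; rewrite ?big_nil. Qed.

Lemma ballM m n g h : ball m g -> ball n h -> ball (m + n) (g * h).
Proof.
move=> [v vm <-] [w wn <-]; exists (v ++ w); last by rewrite big_cat.
by rewrite size_cat leq_add.
Qed.

Lemma ballV n g : ball n g -> ball n g^-1.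
Proof.
move=> [w]; elim: w n g => [|i w IHw] n g wn <-.
  by rewrite big_nil invg1; apply: ball1.
case: n wn => // n wn; rewrite big_cons invgM -addn1.
apply: ballM; first exact: IHw wn _.
by have [j <-] := sV i; exists [:: j] => //; rewrite big_seq1.
Qed.

Lemma ball_gen n i f : f <= n -> ball n (s i ^+ f).
Proof.
move=> fn; exists (nseq f i); first by rewrite size_nseq.
by elim: f {fn} => [|f IHf]; rewrite ?big_nil //= big_cons IHf expgS.
Qed.

Lemma ball_commg m n g h :
  ball m g -> ball n h -> ball (m + n + (m + n)) [~ g, h].
Proof.
move=> bg bh; rewrite commgEl conjgE mulgA -invgM {1}[(m + n)%N]addnC.
by apply: ballM; [apply/ballV/ballM | apply: ballM].
Qed.

Local Notation scale n := (n%:R^-1 : R)%R.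

Lemma scale_ge0 n : (0 <= scale n)%R.
Proof. by rewrite invr_ge0 ler0n. Qed.

Lemma scale_le1 n f j : 0 < n -> f <= n ^ j -> (f%:R * scale n ^+ j <= 1)%R.
Proof.
move=> n0 fn; rewrite exprVn -natrX ler_pdivrMr ?mul1r ?ler_nat //.
by rewrite ltr0n expn_gt0 n0.
Qed.

(** Each leaf costs 1/n: this turns length bounds linear in [n] into norm bounds free of [n]. *)
Lemma wnorm_leaves n K (w : seq I) : 0 < n -> size w <= K * n ->
  (wnorm (scale n) [seq Leaf i | i <- w] <= K%:R)%R.
Proof.
move=> n0 wK; rewrite /wnorm big_map /= (eq_bigr (fun=> scale n)) => [|i _].
  rewrite big_const_seq count_predT iter_addr_0 -[leLHS]mulr_natl.
  by rewrite ler_pdivrMr ?ltr0n // -natrM ler_nat.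
exact: expr1.
Qed.

(* A power [ev t ^+ f] with [f <= n ^ weight t] has length O(n) modulo heavier
   letters, because an f1-st power commuted with an f2-nd one yields f1 * f2
   copies of the commutator. *)
Lemma short_power t : exists K (C : R), forall n f, 0 < n ->
  f <= n ^ weight t ->
  exists U, [/\ all (fun u => weight t < weight u) U,
    (wnorm (scale n) U <= C)%R & ball (K * n) (ev s t ^+ f * evw s U)].
Proof.
elim: t => [i|t1 [K1 [C1 IH1]] t2 [K2 [C2 IH2]]].
  exists 1%N, 0%R => n f n0; rewrite expn1 => fn; exists [::].
  by rewrite wnorm_nil evw_nil mulg1 mul1n; split=> //; apply: ball_gen.
pose c1 := (1 + C1)%R; pose c2 := (1 + C2)%R.
pose D := ((c1 * expR c1) * (c2 * expR c2))%R.
pose z := Node t1 t2.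
have step n f1 f2 : 0 < n -> f1 <= n ^ weight t1 -> f2 <= n ^ weight t2 ->
    exists V, [/\ all (led_by z) V, count_mem z V = (f1 * f2)%N,
      (wnorm (scale n) V <= D)%R & ball (2 * (K1 + K2) * n) (evw s V)].
  move=> n0 fn1 fn2; have q0 := scale_ge0 n.
  have [U1 [hU1 nU1 bU1]] := IH1 n f1 n0 fn1.
  have [U2 [hU2 nU2 bU2]] := IH2 n f2 n0 fn2.
  have led f t U : all (fun u => weight t < weight u) U ->
      all (led_by t) (nseq f t ++ U) /\ count_mem t (nseq f t ++ U) = f.
    move=> hU; rewrite all_cat count_cat all_nseq count_nseq /led_by /= !eqxx.
    rewrite orbT mul1n; split; first by apply: sub_all hU => u ->; rewrite orbT.
    rewrite (_ : count _ U = 0%N) ?addn0 //.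
    apply/eqP; rewrite -leqn0 leqNgt -has_count.
    by apply/hasPn => u /(allP hU); apply: contraTneq => ->; rewrite ltnn.
  have norm f t U (C : R) : f <= n ^ weight t -> (wnorm (scale n) U <= C)%R ->
      (wnorm (scale n) (nseq f t ++ U) <= 1 + C)%R.
    by move=> fn nU; rewrite wnorm_cat wnorm_nseq lerD // scale_le1.
  have [l1 e1] := led f1 _ _ hU1; have [l2 e2] := led f2 _ _ hU2.
  have n1 := norm _ _ _ _ fn1 nU1; have n2 := norm _ _ _ _ fn2 nU2.
  have [l e] := commw_led_by l1 l2.
  exists (commw (nseq f1 t1 ++ U1) (nseq f2 t2 ++ U2)); split=> //.
  - by rewrite e e1 e2.
  - apply: le_trans (wnorm_commw _ _ q0) _.
    by do !apply: ler_pM; rewrite ?mulr_ge0 ?wnorm_ge0 ?expR_ge0 ?ler_expR.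
  - rewrite evw_commw !evw_cat !evw_nseq mul2n -addnn mulnDl mulnDl.
    exact: ball_commg.
exists (2 * (2 * (K1 + K2)))%N, (2%:R * D * expR 1)%R => n f n0 /= fn.
have q0 := scale_ge0 n.
(* Division by [N] gives f = (f / N) N + 1 (f mod N), two products whose factors are within the
   bounds of [step]. *)
pose N := (n ^ weight t2)%N; have N0 : 0 < N by rewrite expn_gt0 n0.
have [V1 [l1 e1 nV1 bV1]] : exists V, [/\ all (led_by z) V,
    count_mem z V = (f %/ N * N)%N, (wnorm (scale n) V <= D)%R &
    ball (2 * (K1 + K2) * n) (evw s V)].
  apply: step => //; apply: leq_trans (leq_div2r _ fn) _.
  by rewrite expnD mulnK.
have [V2 [l2 e2 nV2 bV2]] : exists V, [/\ all (led_by z) V,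
    count_mem z V = (1 * (f %% N))%N, (wnorm (scale n) V <= D)%R &
    ball (2 * (K1 + K2) * n) (evw s V)].
  by apply: step; rewrite ?expn_gt0 ?n0 // ltnW // ltn_mod.
have count_f : count_mem z (V1 ++ V2) = f.
  by rewrite count_cat e1 e2 mul1n -divn_eq.
(* [V1 ++ V2] has exactly [f] copies of [z]; collecting them in front leaves a word [U] in heavier
   letters. *)
have [|U [hU eU nU]] := @extract_letter R _ _ s (scale n) _ z (V1 ++ V2) q0
  (@comm_closed_weight I (weight z)).
  by rewrite all_cat; apply/andP.
exists U; split=> //.
  apply: le_trans nU _; rewrite count_f wnorm_cat.
  apply: ler_pM; rewrite ?addr_ge0 ?wnorm_ge0 ?expR_ge0 //.
    by rewrite mulr_natl mulr2n lerD.
  by rewrite ler_expR scale_le1.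
move: eU; rewrite count_f => <-; rewrite evw_cat -mulnA mul2n -addnn.
exact: ballM.
Qed.

(** * Covering words by boundedly many translates of balls *)

(** The order of quantifiers matters: [K] is fixed before the size [C] of the words, and [l] is
    uniform in [n]. *)
Definition covered (P : pred (comm_tree I)) := exists K, forall C : R,
  exists l, forall n, 0 < n -> exists2 X : seq G, size X <= l &
    forall W, all P W -> (wnorm (scale n) W <= C)%R ->
      exists2 x, x \in X & ball (K * n) (x^-1 * evw s W).

Lemma eq_covered P Q : P =1 Q -> covered P -> covered Q.
Proof.
move=> PQ [K cov]; exists K => C; have [l covC] := cov C; exists l => n n0.
have [X Xl covn] := covC n n0; exists X => // W QW; apply: covn.
by rewrite (eq_all PQ).
Qed.

(** Let W = z^e V, e = q N + f, and let Y = z^(N - f) U be short. Then W = z^((q+1) N) (U V^Y) Y^-1,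
    where the middle word satisfies [P] and has bounded norm, and Y^-1 is short. *)
Lemma covered_step (P : pred (comm_tree I)) z : comm_closed P ->
  (forall t, weight z < weight t -> P t) ->
  covered P -> covered (fun t => (t == z) || P t).
Proof.
move=> clP heavyP [K' cov].
have [Kz [Cz short]] := short_power z.
exists (K' + Kz)%N => C.
pose m := Num.bound `|C|%R.
(* [Cz] bounds [U]; extracting z costs [V] a factor exp [m], and conjugating by [Y] a factor exp
   [Kz]. *)
pose C' := (Cz + C * expR m%:R * expR Kz%:R)%R.
have [l' covl] := cov C'.
exists (m.+1 * l')%N => n n0.
have q0 := scale_ge0 n.
pose N := (n ^ weight z)%N; have N0 : 0 < N by rewrite expn_gt0 n0.
have [X' Xl' covX] := covl n n0.
exists [seq ev s z ^+ (q.+1 * N) * x | q <- iota 0 m.+1, x <- X'].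
  by rewrite size_allpairs size_iota leq_mul.
move=> W PW nW; have [V [PV eV nV]] := extract_letter s q0 clP PW.
move: (count_le_wnorm z W q0) eV nV; set e := count_mem z W => ce eV nV.
have Cm : (C <= m%:R)%R.
  by apply: le_trans (ler_norm _) _; rewrite ltW // archi_boundP.
have em : (e%:R * scale n ^+ weight z <= m%:R)%R.
  by apply: le_trans ce (le_trans nW Cm).
have eN : e <= m * N.
  rewrite -(ler_nat R) natrM natrX -ler_pdivrMr -?exprVn //.
  by rewrite exprn_gt0 // ltr0n.
have fN : N - e %% N <= n ^ weight z by rewrite leq_subr.
have [U [hU nU [w wK ew]]] := short n _ n0 fN.
pose Y := [seq Leaf i | i <- w].
have eY : evw s Y = \prod_(i <- w) s i by rewrite /evw big_map.
have nY : (wnorm (scale n) Y <= Kz%:R)%R by apply: wnorm_leaves.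
have [||x xX bx] := covX (U ++ conjw V Y).
- by rewrite all_cat all_conjw // andbT; apply: sub_all hU.
- rewrite wnorm_cat lerD //; apply: le_trans (wnorm_conjw _ _ q0) _.
  apply: ler_pM; rewrite ?wnorm_ge0 ?expR_ge0 ?ler_expR //.
  apply: le_trans nV _; apply: ler_pM; rewrite ?wnorm_ge0 ?expR_ge0 ?ler_expR //.
exists (ev s z ^+ ((e %/ N).+1 * N) * x).
  apply/allpairsP; exists (e %/ N, x); split=> //.
  by rewrite mem_iota add0n ltnS -(mulnK m N0) leq_div2r.
(* Overshooting to the next multiple of [N] makes [U] enter uninverted, as words have no inverse
   letters. *)
have e_split : ((e %/ N).+1 * N = e + (N - e %% N))%N.
  by rewrite mulSn {2}(divn_eq e N) addnC -addnA subnKC // ltnW // ltn_mod.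
have -> : (ev s z ^+ ((e %/ N).+1 * N) * x)^-1 * evw s W =
          x^-1 * evw s (U ++ conjw V Y) * (evw s Y)^-1.
  rewrite evw_cat evw_conjw conjgE eV e_split expgnDr eY ew !invgM !mulgA.
  by rewrite !mulgK !mulgVK.
rewrite mulnDl; apply: ballM => //; apply: ballV.
by rewrite eY; exists w.
Qed.

(** The trees of height at most [k]. Weight exceeds height, so every tree of weight at most k+1 is
    listed, and each weight has finitely many letters. *)
Fixpoint trees_upto k : seq (comm_tree I) :=
  if k is k'.+1
  then trees_upto k' ++ [seq Node t u | t <- trees_upto k', u <- trees_upto k']
  else [seq Leaf i | i <- enum I].

Lemma mem_trees_upto k t : weight t <= k.+1 -> t \in trees_upto k.
Proof.
elim: k t => [|k IHk] [i|t u] /=.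
- by move=> _; rewrite map_f ?mem_enum.
- have tu : 1 < weight t + weight u := leq_add (weight_gt0 t) (weight_gt0 u).
  by rewrite leqNgt tu.
- by move=> _; rewrite mem_cat IHk.
move=> tu; rewrite mem_cat; apply/orP; right; apply: allpairs_f; apply: IHk.
  by rewrite -ltnS (leq_trans _ tu) // -addn1 leq_add2l weight_gt0.
by rewrite -ltnS (leq_trans _ tu) // -add1n leq_add2r weight_gt0.
Qed.

(** Descending induction on [j], with at most [k] weights left before all letters evaluate to 1. *)
Lemma covered_weight M k j : (forall t, M <= weight t -> ev s t = 1) ->
  M <= j + k -> covered (fun t => j < weight t).
Proof.
move=> triv; elim: k j => [|k IHk] j Mjk.
  exists 0%N => C; exists 1%N => n n0; exists [:: 1] => // W hW _.
  exists 1; rewrite ?mem_head // invg1 mul1g /evw big_seq big1 => [|t tW].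
    exact: ball1.
  by apply: triv; rewrite (leq_trans Mjk) // addn0 ltnW // (allP hW).
have {}IHk : covered (fun t => j.+1 < weight t) by apply: IHk; rewrite addSnnS.
(* The finitely many letters of weight [j.+1] are adjoined one at a time, in any order: [Node t u]
   with [t] among them is already heavier. *)
suff cov (F : seq (comm_tree I)) : all (fun t => weight t == j.+1) F ->
    covered (fun t => (t \in F) || (j.+1 < weight t)).
  apply: eq_covered (cov [seq t <- trees_upto j | weight t == j.+1] _).
    move=> t; rewrite mem_filter [j < _]leq_eqVlt [j.+1 == _]eq_sym.
    by case: eqP => //= tj; rewrite mem_trees_upto ?tj.
  exact: filter_all.
elim: F => [_|z F IHF /= /andP[/eqP wz wF]]; first exact: eq_covered IHk.
apply: (@eq_covered (fun t => (t == z) || ((t \in F) || (j.+1 < weight t)))).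
  by move=> t; rewrite in_cons orbA.
apply: covered_step; last exact: IHF.
- move=> t u /orP tF; apply/orP; right; rewrite /= -addn1.
  case: tF => [/(allP wF)/eqP ->|jt]; first by rewrite leq_add2l weight_gt0.
  by rewrite addn1 (leq_trans jt) // leq_addr.
- by move=> t; rewrite wz => ->; rewrite orbT.
Qed.

Theorem ball_covering M : (forall t, M <= weight t -> ev s t = 1) ->
  exists K, forall C, exists l, forall n, 0 < n ->
    exists2 X : seq G, size X <= l & forall g, ball (C * n) g ->
      exists2 x, x \in X & ball (K * n) (x^-1 * g).
Proof.
move=> triv; have [K cov] := @covered_weight M M 0 triv (leqnn M).
exists K => C; have [l covC] := cov C%:R%R; exists l => n n0.
have [X Xl covX] := covC n n0; exists X => // g [w wC <-].
have [||x xX] := covX [seq Leaf i | i <- w].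
- by apply/allP => t _; rewrite weight_gt0.
- exact: wnorm_leaves.
by rewrite /evw big_map; exists x.
Qed.

End Doubling.

(** * Subgroups, coset representatives and powers of sets *)

Section Groups.
Variable G : groupType.
Implicit Types (A H : set G).
Local Open Scope classical_set_scope.
Local Open Scope card_scope.

Lemma is_subgroupP H : is_subgroup H <->
  [/\ H 1, forall x y, H x -> H y -> H (x * y) & forall x, H x -> H x^-1].
Proof.
split=> [sH|[H1 HM HV]].
  split; first by have := sH.1; rewrite inE.
  - move=> x y Hx Hy; have := group_closedM sH (mem_set Hx) (mem_set Hy).
    by rewrite inE.
  - by move=> x Hx; have := group_closedV sH (mem_set Hx); rewrite inE.
split; first exact: mem_set.
by move=> x y; rewrite !inE => Hx Hy; apply: HM => //; apply: HV.
Qed.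

Lemma gen_subgroup_subgroup A : is_subgroup (gen_subgroup A).
Proof.
apply/is_subgroupP; split=> [|x y gx gy|x gx] H [sH AH];
  have [H1 HM HV] := (is_subgroupP H).1 sH => //.
- by apply: HM; [apply: gx | apply: gy].
- by apply: HV; apply: gx.
Qed.

Lemma sub_gen_subgroup A : A `<=` gen_subgroup A.
Proof. by move=> x Ax H [_]; apply. Qed.

(* A formal commutator of weight at least 2^k has depth at least k, which
   avoids the inclusion of [gamma_a, gamma_b] in gamma_(a+b). *)
Lemma lower_central_ev (I : finType) (s : I -> G) H k t :
  is_subgroup H -> (forall i, H (s i)) -> 2 ^ k <= weight t ->
  lower_central H k (ev s t).
Proof.
move=> sH Hs; have [H1 HM HV] := (is_subgroupP H).1 sH.
have Hev u : H (ev s u).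
  elim: u => //= u Hu v Hv; rewrite commgEl conjgE.
  exact: (HM _ _ (HV _ Hu) (HM _ _ (HV _ Hv) (HM _ _ Hu Hv))).
elim: k t => [|k IHk] t; first by move=> _; apply: Hev.
case: t => [i|t u]; first by rewrite expnS leqNgt leq_pmulr // expn_gt0.
have [tk _|tk] := leqP (2 ^ k) (weight t).
  by apply: sub_gen_subgroup; exists (ev s t); [exact: IHk|exists (ev s u)].
rewrite expnS mul2n -addnn /= => tuk.
have uk : 2 ^ k <= weight u.
  rewrite leqNgt; apply/negP => uk; move: tuk; rewrite leqNgt.
  by rewrite -addnS leq_add // ltnW.
(* [lower_central] has its deep entry on the left, so the commutator is written as the inverse of
   the swapped one. *)
rewrite -invgR.
have [_ _ gV] := (is_subgroupP _).1 (gen_subgroup_subgroup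
   [set [~ x, y] | x in lower_central H k & y in H]).
apply: gV; apply: sub_gen_subgroup.
by exists (ev s u); [exact: IHk|exists (ev s t)].
Qed.

(** Representatives are taken inside [Gam], so that the Schreier generators built from them lie in
    [Gam]. *)
Lemma coset_reps H Gam : is_subgroup H -> finite_index H ->
  exists2 R : seq G, {in R, forall r, Gam r} &
    forall g, Gam g -> exists2 r, r \in R & H (r^-1 * g).
Proof.
move=> /is_subgroupP[H1 HM HV] fH.
(* A coset that misses [Gam] gets the default 1, which the filter discards if it is outside
   [Gam]. *)
pose f (c : set G) := xget 1 (c `&` Gam).
have /finite_seqP[R0 eR0] := finite_image f fH.
exists [seq r <- R0 | `[< Gam r >]].
  by move=> r; rewrite mem_filter => /andP[/asboolP].
move=> g Gg; pose c := [set g * y | y in H].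
have [[y Hy fE] Gf] : (c `&` Gam) (f c).
  apply: (@xgetPex _ 1 (c `&` Gam)); exists g; split=> //.
    by exists 1; rewrite ?mulg1.
exists (f c); last by rewrite -fE invgM mulgVK; apply: HV.
rewrite mem_filter; apply/andP; split; first exact/asboolP.
have : [set` R0] (f c) by rewrite -eR0; exists c => //; exists g.
by [].
Qed.

Lemma set_expgP A h g : set_expg A h g <->
  exists w : seq G, [/\ size w = h, {in w, forall x, A x} & \prod_(x <- w) x = g].
Proof.
split=> [[e Ae <-]|[w [<- Aw <-]]].
  exists [seq e i | i <- enum 'I_h]; rewrite size_map size_enum_ord; split=> //.
    by move=> _ /mapP[i _ ->]; apply: Ae.
  by rewrite big_map enumT [index_enum _]unlock.
exists (fun i : 'I_(size w) => nth 1 w i); last by rewrite (big_nth 1) big_mkord.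
by move=> i; apply: Aw; rewrite mem_nth.
Qed.

Lemma set_expgM A m n x y :
  set_expg A m x -> set_expg A n y -> set_expg A (m + n) (x * y).
Proof.
move=> /set_expgP[v [<- Av <-]] /set_expgP[w [<- Aw <-]]; apply/set_expgP.
exists (v ++ w); rewrite size_cat big_cat; split=> //.
by move=> z; rewrite mem_cat => /orP[/Av|/Aw].
Qed.

Lemma set_expg0 A : set_expg A 0 1.
Proof. by apply/set_expgP; exists [::]; rewrite big_nil. Qed.

Lemma set_expg_expgn A m n x : set_expg A m x -> set_expg A (n * m) (x ^+ n).
Proof.
move=> Ax; elim: n => [|n IHn]; first exact: set_expg0.
by rewrite mulSn expgS; apply: set_expgM.
Qed.

Lemma set_expg_sub A H h : is_subgroup H -> A `<=` H -> set_expg A h `<=` H.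
Proof.
move=> /is_subgroupP[H1 HM _] AH x /set_expgP[w [_ Aw <-]] {x h}.
by rewrite big_seq; apply: (big_ind H) => // x /Aw /AH.
Qed.

Lemma card_le_seq (X : seq G) l : size X <= l -> [set` X] #<= `I_l.
Proof.
move=> Xl; rewrite -card_le_II in Xl; apply: card_le_trans Xl.
apply: card_le_trans (card_image_le (nth 1 X) _); apply: subset_card_le.
by move=> x /= xX; exists (index x X); rewrite /= ?nth_index ?index_mem.
Qed.

(** * Schreier rewriting and semigroup generation *)

Lemma virtually_nilpotent_covering A Gam :
  virtually_nilpotent G -> finite_set A -> is_subgroup Gam -> A `<=` Gam ->
  (forall x, Gam x -> exists h, set_expg A h x) ->
  exists D, forall C, exists l, forall n, 0 < n ->
    exists2 X : seq G, size X <= l &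
      forall h g, h <= C * n -> set_expg A h g ->
        exists x j, [/\ x \in X, j <= D * n & set_expg A j (x^-1 * g)].
Proof.
move=> [H [sH [c nilH] fH]] /finite_seqP[sA eA] sGam AGam genA.
have [H1 HM HV] := (is_subgroupP _).1 sH.
have [G1 GM GV] := (is_subgroupP _).1 sGam.
have [reps repsG repsH] := coset_reps Gam sH fH.
(* The extra 1 represents the empty product, where the rewriting starts. [T0] then consists of the
   Schreier generators r^-1 a p lying in [H]. *)
pose moves := [seq a * p | a <- sA, p <- 1 :: reps].
pose T0 := [seq x <- [seq r^-1 * y | r <- reps, y <- moves] | `[< H x >]].
pose T := T0 ++ [seq x^-1 | x <- T0].
pose s (i : 'I_(size T)) := nth 1 T i.
have sT x : x \in T -> exists i, s i = x.
  move=> xT; have iT : index x T < size T by rewrite index_mem.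
  by exists (Ordinal iT); rewrite /s nth_index.
have Ts i : s i \in T by rewrite mem_nth.
have rep1G p : p \in 1 :: reps -> Gam p.
  by rewrite in_cons => /orP[/eqP->//|]; apply: repsG.
have AsA a : a \in sA -> A a by rewrite eA.
have TG x : x \in T -> H x /\ Gam x.
  have T0G y : y \in T0 -> H y /\ Gam y.
    rewrite mem_filter => /andP[/asboolP Hy /allpairsP[[r z] /= [rr zm ey]]].
    split=> //; have /allpairsP[[a p] /= [aA pr ez]] := zm.
    rewrite ey ez.
    exact: (GM _ _ (GV _ (repsG _ rr)) (GM _ _ (AGam _ (AsA _ aA)) (rep1G _ pr))).
  rewrite mem_cat => /orP[/T0G//|/mapP[y /T0G[Hy Gy] ->]].
  by split; [apply: HV | apply: GV].
have sV i : exists j, s j = (s i)^-1.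
  apply: sT; have := Ts i; rewrite !mem_cat => /orP[iT|/mapP[y yT ->]].
    by rewrite map_f ?orbT.
  by rewrite invgK yT.
have triv t : 2 ^ c <= weight t -> ev s t = 1.
  move=> ct; have : lower_central H c (ev s t).
    by apply: lower_central_ev => // i; apply: (TG _ (Ts i)).1.
  by rewrite nilH.
have [K cov] := ball_covering Rdefinitions.R sV triv.
(* Semigroup generation writes every element of [T], inverses included, as a product of elements of
   [A] alone. *)
have [k genk] : exists k : 'I_(size T) -> nat, forall i, set_expg A (k i) (s i).
  have gen i : exists j, set_expg A j (s i) := genA _ (TG _ (Ts i)).2.
  by have [k genk] := choice gen; exists k.
pose K1 := \max_i k i.
have ballA n g : ball s n g -> exists2 j, j <= K1 * n & set_expg A j g.
  move=> [w wn <-]; elim: w n wn => [|i w IHw] n wn.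
    by exists 0%N => //; rewrite big_nil; apply: set_expg0.
  case: n wn => // n /IHw[j jn Aj]; exists (k i + j)%N.
    by rewrite mulnS leq_add // leq_bigmax.
  by rewrite big_cons; apply: set_expgM.
(* Schreier rewriting: r^-1 (a w) = (r^-1 a p) (p^-1 w), so each letter from [A] costs one letter of
   [T]. *)
have Aball h g : set_expg A h g ->
    exists2 r, r \in 1 :: reps & ball s h (r^-1 * g) /\ Gam g.
  move=> /set_expgP[w [<- Aw <-]]; elim: w Aw => [|a w IHw] Aw.
    exists 1; rewrite ?mem_head // big_nil invg1 mulg1.
    by split; [apply: ball1 | apply: G1].
  have [|p pr [bp Gw]] := IHw.
    by move=> x xw; apply: Aw; rewrite in_cons xw orbT.
  have Aa : A a by apply: Aw; rewrite mem_head.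
  have Gp := rep1G _ pr.
  have [r rr Hr] := repsH (a * p) (GM _ _ (AGam _ Aa) Gp).
  exists r; first by rewrite in_cons rr orbT.
  rewrite big_cons; split; last exact: GM (AGam _ Aa) Gw.
  have [i si] : exists i, s i = r^-1 * (a * p).
    apply: sT; rewrite mem_cat mem_filter; apply/orP; left; apply/andP; split.
      exact/asboolP.
    by apply: allpairs_f => //; apply: allpairs_f => //; rewrite eA in Aa.
  have -> : r^-1 * (a * \prod_(x <- w) x) = s i * (p^-1 * \prod_(x <- w) x).
    by rewrite si !mulgA mulgK.
  apply: (@ballM _ _ s 1) => //.
  by exists [:: i]; rewrite ?big_seq1.
exists (K1 * K)%N => C; have [l covC] := cov C.
exists ((size reps).+1 * l)%N => n n0; have [X Xl covX] := covC n n0.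
exists [seq r * x | r <- 1 :: reps, x <- X].
  by rewrite size_allpairs leq_mul.
move=> h g hC /Aball[r rr [/(ballW hC)/covX[x xX /ballA[j jn Aj]] _]].
exists (r * x), j; split; first exact: allpairs_f.
  by rewrite -mulnA.
by rewrite invgM -mulgA.
Qed.

Lemma set_expg_covering A Gam :
  virtually_nilpotent G -> finite_set A -> A !=set0 ->
  is_subgroup Gam -> A `<=` Gam ->
  Gam = \bigcup_(h in [set h : nat | (1 <= h)%N]) set_expg A h ->
  forall r, exists l h0, [/\ 0 < l, 0 < h0 & forall h, h0 <= h ->
    exists X : set G, [/\ X `<=` Gam, X #<= `I_l &
      set_expg A (r * h)%N `<=` set_mulg X (set_expg A h)]].
Proof.
move=> vG fA [a Aa] sGam AGam eGam r.
have [G1 GM GV] := (is_subgroupP _).1 sGam.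
have genA x : Gam x -> exists h, set_expg A h x.
  by rewrite eGam => -[h _ Ahx]; exists h.
have [m m0 Am] : exists2 m, 0 < m & set_expg A m 1.
  by have := G1; rewrite eGam => -[h h0 Ah]; exists h.
have [D0 cov] := virtually_nilpotent_covering vG fA sGam AGam genA.
(* The successor makes the divisor positive. For n = h / D >= 1, both D n <= h and h <= 2 D n hold,
   so r h <= (2 r D) n. *)
pose D := D0.+1; have [l covl] := cov (2 * r * D)%N.
exists (l * m).+1, D; split=> // h Dh.
have n0 : 0 < h %/ D by rewrite divn_gt0.
have [X Xl covX] := covl _ n0.
pose Xa := [seq x * (a ^+ i)^-1 | x <- X, i <- iota 0 m].
(* The filter loses no translate in use: there x a^-i = g b^-1 with [g] and [b] in [Gam]. *)
exists [set` [seq x <- Xa | `[< Gam x >]]].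
split.
- by move=> x /=; rewrite mem_filter => /andP[/asboolP].
- apply: card_le_seq; rewrite size_filter (leq_trans (count_size _ _)) //.
  by rewrite size_allpairs size_iota ltnW // ltnS leq_mul.
move=> g Ag; have [|x [j [xX jD Aj]]] := covX _ _ _ Ag.
  rewrite [(2 * r)%N]mulnC -!mulnA leq_mul //.
  have hD : h < (h %/ D).+1 * D by exact: ltn_ceil.
  rewrite (leq_trans (ltnW hD)) // mulSn mul2n -addnn [(D * _)%N]mulnC leq_add2r.
  by rewrite leq_pmull.
have jh : j <= h.
  apply: leq_trans jD _; apply: leq_trans (leq_divM h D).
  by rewrite mulnC leq_mul.
(* With h - j = q m + i, the product a^i 1^q (x^-1 g) lies in A^h exactly, as 1 is in A^m. *)
pose i := ((h - j) %% m)%N; pose b := a ^+ i * (x^-1 * g).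
have Aa1 : set_expg A 1 a.
  apply/set_expgP; exists [:: a]; rewrite big_seq1; split=> // y.
  by rewrite inE => /eqP->.
have Ab : set_expg A h b.
  have Ai := set_expg_expgn i Aa1; have Aq := set_expg_expgn ((h - j) %/ m) Am.
  have := set_expgM Ai (set_expgM Aq Aj).
  rewrite expg1n mul1g muln1 addnA [(i + _)%N]addnC -divn_eq subnK //.
have Gg : Gam g := set_expg_sub sGam AGam Ag.
have Gb : Gam b := set_expg_sub sGam AGam Ab.
have eg : x * (a ^+ i)^-1 * b = g by rewrite /b !mulgA mulgVK mulgV mul1g.
exists (x * (a ^+ i)^-1); last by exists b.
rewrite /= mem_filter; apply/andP; split.
  apply/asboolP; rewrite -[_ * _](mulgK b) eg.
  by apply: GM => //; apply: GV.
by apply: allpairs_f => //; rewrite mem_iota ltn_mod.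
Qed.

End Groups.

Unset Implicit Arguments.
Local Open Scope classical_set_scope.
Local Open Scope card_scope.

Theorem theorem1p5 (G : groupType) (A : set G)
    (hG : virtually_nilpotent G)
    (A_fin : finite_set A) (A_neq0 : A !=set0)
    (A_gen : gen_subgroup A =
             \bigcup_(h in [set h : nat | (1 <= h)%N]) set_expg A h) :
  (forall r : nat, (1 <= r)%N ->
     exists l h0 : nat, [/\ (1 <= l)%N, (1 <= h0)%N &
       forall h : nat, (h0 <= h)%N ->
         exists X : set G,
           [/\ X `<=` gen_subgroup A,
               X #<= `I_l &
               set_expg A (r * h)%N `<=` set_mulg X (set_expg A h)]]) /\
  asymptotic_approximate_group A.
Proof.
have cov := set_expg_covering hG A_fin A_neq0 (@gen_subgroup_subgroup G A)
  (@sub_gen_subgroup G A) A_gen.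
split=> r _; first by have [l [h0 ?]] := cov r; exists l, h0.
have [l [h0 [l0 h00 covr]]] := cov r; exists l; split=> //; split=> //.
exists h0; split=> // h /covr[X [_ Xl AX]]; exists X; split=> //.
Qed.
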